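(* Let $\lambda\in\mathbb{R}$. For every integer $n\ge 0$, all $a,b\in\mathbb{R}$ with $b\neq 0$, and all real $x>0$ with $x\ne 1$, $$x^{n\lambda}\left(x^{1-\lambda}\frac{d}{dx}\right)^{n}\left(\frac{x^{a}}{1-x^{b}}\right)=\frac{x^{a}}{1-x^{b}}\,S_{n,\lambda}\left(\frac{x^{b}}{1-x^{b}};a,b\right),$$ where $S_{n,\lambda}(x;a,b)$ is the polynomial in $x$ $$S_{n,\lambda}(x;a,b)=b^{n}\sum_{k=0}^{n}\binom{n}{k}\left(\frac{a}{b}\right)_{n-k,\frac{\lambda}{b}}F_{k,\frac{\lambda}{b}}(x).$$
   Context: For $\mu\in\mathbb{R}$, the degenerate falling factorials are $(x)_{0,\mu}=1$ and $(x)_{n,\mu}=x(x-\mu)(x-2\mu)\cdots(x-(n-1)\mu)$ for $n\ge 1$; the falling factorials are $(x)_0=1$, $(x)_n=x(x-1)\cdots(x-n+1)$ for $n\ge1$. The degenerate Stirling numbers of the second kind ${n \brace k}_{\mu}$ ($0\le k\le n$) are defined by the polynomial identity $(x)_{n,\mu}=\sum_{k=0}^{n}{n \brace k}_{\mu}(x)_k$, $n\ge 0$. The degenerate Fubini polynomials are $F_{n,\mu}(x)=\sum_{k=0}^{n}{n \brace k}_{\mu}k!\,x^{k}$, $n\ge0$. The operator $\left(x^{1-\lambda}\frac{d}{dx}\right)^n$ is the $n$-fold composition of the operator $h\mapsto x^{1-\lambda}\,\frac{dh}{dx}$. *)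

(* Defs.v *)
From HB Require Import structures.
From mathcomp Require Import all_boot all_order all_algebra.
From mathcomp Require Import all_classical all_reals all_analysis.
Set Implicit Arguments.
Unset Strict Implicit.
Unset Printing Implicit Defensive.
Import Order.TTheory GRing.Theory Num.Theory.
Import numFieldNormedType.Exports.
Local Open Scope ring_scope.

(* Both factorials live in an arbitrary commutative ring, so that they can be
   taken at a number as well as at the indeterminate 'X. *)
Definition degen_falling (T : comNzRingType) (mu x : T) (n : nat) : T :=
  \prod_(i < n) (x - mu *+ i).

Definition falling (T : comNzRingType) (x : T) (n : nat) : T :=
  \prod_(i < n) (x - i%:R).

(* Only the values s n k with k <= n are constrained. *)
Definition is_degen_stirling2 (R : numFieldType) (mu : R)
    (s : nat -> nat -> R) : Prop :=
  forall n, degen_falling mu%:P 'X n =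
            \sum_(k < n.+1) s n k *: falling ('X : {poly R}) k.

Lemma degen_stirling2_exists (R : numFieldType) (mu : R) :
  exists s, is_degen_stirling2 mu s.
Proof.
pose s := fix s n k : R := match n, k with
  | 0%N, 0%N => 1
  | 0%N, _.+1 => 0
  | m.+1, 0%N => - (mu *+ m) * s m 0%N
  | m.+1, j.+1 => s m j + (j.+1%:R - mu *+ m) * s m j.+1
  end.
have s0 n k : (n < k)%N -> s n k = 0.
  elim: n k => [|n IHn] [|k] //= nk.
  by rewrite !IHn ?mulr0 ?addr0 // ltnW.
have fS (k n : nat) : falling ('X : {poly R}) k * ('X - mu%:P *+ n) =
    falling 'X k.+1 + (k%:R - mu *+ n) *: falling 'X k.
  rewrite /falling big_ord_recr /= -mul_polyC polyCB polyC_natr polyCMn.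
  by rewrite [(_ - _) * _]mulrC -mulrDr addrA subrK.
exists s => n; elim: n => [|n IHn].
  by rewrite /degen_falling /falling big_ord1 !big_ord0 scale1r.
rewrite /degen_falling big_ord_recr -/(degen_falling _ _ n) IHn /= mulr_suml.
under [LHS]eq_bigr => k _ do rewrite -scalerAl fS scalerDr scalerA.
rewrite big_split /= [RHS]big_ord_recl /=.
under [X in _ = _ + X]eq_bigr => k _ do rewrite /= scalerDl.
rewrite big_split /= addrCA; congr (_ + _).
rewrite big_ord_recl [X in _ = _ + X]big_ord_recr /=.
rewrite (s0 n n.+1) // mulr0 scale0r addr0 sub0r [_ * s n _]mulrC.
by congr (_ + _); apply: eq_bigr => k _; rewrite /= [_ * s n _]mulrC.
Qed.

Lemma degen_stirling2_unique (R : numFieldType) (mu : R) s t :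
  is_degen_stirling2 mu s -> is_degen_stirling2 mu t ->
  forall n k, (k <= n)%N -> s n k = t n k.
Proof.
move=> sP tP n; elim/ltn_ind => k IHk le_kn.
have fE m j : (falling ('X : {poly R}) j).[m%:R] = falling (m%:R : R) j.
  rewrite /falling horner_prod; apply: eq_bigr => i _.
  by rewrite hornerD hornerN hornerX -polyC_natr hornerC.
have f0 j : (k < j)%N -> falling (k%:R : R) j = 0.
  by move=> kj; rewrite /falling (bigD1 (Ordinal kj)) //= subrr mul0r.
have fk : falling (k%:R : R) k != 0.
  by apply/prodf_neq0=> i _; rewrite subr_eq0 eqr_nat gtn_eqF.
have /(congr1 (horner^~ k%:R)) := etrans (esym (sP n)) (tP n).
rewrite !horner_sum.
have ltk : (k < n.+1)%N by [].
rewrite (bigD1 (Ordinal ltk)) //= [RHS](bigD1 (Ordinal ltk)) //= !hornerZ fE.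
rewrite [X in _ + X = _](eq_bigr (fun i : 'I_n.+1 => (t n i *: falling 'X i).[k%:R])).
  by move/addIr/(mulIf fk).
move=> i nei; rewrite !hornerZ fE; case: (ltngtP i k) => [ik|ki|ik].
- by rewrite IHk // -ltnS.
- by rewrite f0 // !mulr0.
- by case/eqP: nei; apply: val_inj.
Qed.

Definition degen_stirling2 (R : numFieldType) (mu : R) : nat -> nat -> R :=
  sval (cid (degen_stirling2_exists mu)).

Lemma degen_stirling2P (R : numFieldType) (mu : R) :
  is_degen_stirling2 mu (degen_stirling2 mu).
Proof. exact: (svalP (cid (degen_stirling2_exists mu))). Qed.

Definition degen_fubini (R : numFieldType) (mu : R) (n : nat) : {poly R} :=
  \sum_(k < n.+1) (degen_stirling2 mu n k * k`!%:R) *: 'X^k.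

Definition S_poly (R : numFieldType) (lambda a b : R) (n : nat) : {poly R} :=
  b ^+ n *: \sum_(k < n.+1)
    ('C(n, k)%:R * degen_falling (lambda / b) (a / b) (n - k)) *:
      degen_fubini (lambda / b) k.

Definition powd (R : realType) (lambda : R) (h : R -> R) : R -> R :=
  fun x => x `^ (1 - lambda) * derive1 h x.

(* Main.v *)
From HB Require Import structures.
Require Import Defs.
From mathcomp Require Import all_boot all_order all_algebra.
From mathcomp Require Import all_classical all_reals all_analysis.
From mathcomp Require Import ring.
Set Implicit Arguments.
Unset Strict Implicit.
Unset Printing Implicit Defensive.
Import Order.TTheory GRing.Theory Num.Theory.
Import numFieldNormedType.Exports.
Local Open Scope ring_scope.

(** Put u = x^b / (1 - x^b).  Then x du/dx = b u (1 + u) and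
    x d/dx (x^c / (1 - x^b)) = (c + b u) x^c / (1 - x^b), so that x d/dx maps
    x^c / (1 - x^b) * p(u) to

      x^c / (1 - x^b) * (c p + b L p)(u),   L p = X p + (X + X^2) p'

    for every polynomial p (derive1_powR_geometric).  Each application of
    x^(1 - lambda) d/dx also lowers the exponent c by lambda.  Hence the left
    side of the theorem is x^a / (1 - x^b) times the value at u of the
    polynomial Q_n with Q_0 = 1 and

      Q_(n+1) = (a - n lambda) Q_n + b L Q_n,

    and it remains to see that S_(n,lambda) satisfies this recurrence
    (S_polyS).

    This is umbral calculus.  Let U (fubini_umbra) be the linear map that
    sends X^i to L^i 1.  By construction U turns multiplication by X into L,
    and since L X^k = k X^k + (k+1) X^(k+1), it sends the falling factorial
    (X)_k to k! X^k (fubini_umbra_falling).  Thus U maps the expansion that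
    defines the degenerate Stirling numbers to F_(n,mu), that is
    F_(n,mu) = U((X)_(n,mu)), and the Vandermonde identity for degenerate
    falling factorials (degen_fallingD) collapses the sum in the definition
    of S_(n,lambda):

      S_(n,lambda) = b^n U((a/b + X)_(n,lambda/b)).

    The last factor a/b + X - n lambda/b of the next degenerate factorial
    becomes, under U, exactly the operator of the recurrence. *)

Lemma degen_fallingS (T : comNzRingType) (mu x : T) n :
  degen_falling mu x n.+1 = degen_falling mu x n * (x - mu *+ n).
Proof. by rewrite /degen_falling big_ord_recr. Qed.

Lemma degen_falling0 (T : comNzRingType) (mu x : T) : degen_falling mu x 0 = 1.
Proof. by rewrite /degen_falling big_ord0. Qed.

Lemma degen_falling_rmorph (T U : comNzRingType) (f : {rmorphism T -> U})
    (mu x : T) n :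
  f (degen_falling mu x n) = degen_falling (f mu) (f x) n.
Proof.
by rewrite rmorph_prod; apply: eq_bigr => i _; rewrite rmorphB rmorphMn.
Qed.

(** The Vandermonde convolution for degenerate falling factorials.  Induction
    works because the new factor splits as
    x + y - n mu = (x - (n - k) mu) + (y - k mu), whose two halves extend the
    two factorials of the k-th term; Pascal's rule does the rest. *)
Lemma degen_fallingD (T : comNzRingType) (mu x y : T) n :
  degen_falling mu (x + y) n =
  \sum_(k < n.+1)
    degen_falling mu x (n - k) * degen_falling mu y k *+ 'C(n, k).
Proof.
elim: n => [|n IHn]; first by rewrite big_ord1 !degen_falling0 mulr1.
rewrite degen_fallingS IHn mulr_suml.
have splitE (k : 'I_n.+1) :
    degen_falling mu x (n - k) * degen_falling mu y k *+ 'C(n, k) *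
      (x + y - mu *+ n) =
    degen_falling mu x (n - k).+1 * degen_falling mu y k *+ 'C(n, k) +
    degen_falling mu x (n - k) * degen_falling mu y k.+1 *+ 'C(n, k).
  have -> : mu *+ n = mu *+ (n - k) + mu *+ k.
    by rewrite -mulrnDr subnK // leq_ord.
  rewrite !degen_fallingS; ring.
rewrite (eq_bigr _ (fun k _ => splitE k)) big_split /=.
rewrite [RHS]big_ord_recl subn0 bin0.
under [X in _ = _ + X]eq_bigr => k _.
  rewrite lift0 binS subSS mulrnDr.
  over.
rewrite big_split /= addrA; congr (_ + _).
rewrite [X in _ = _ + X]big_ord_recr /= bin_small // mulr0n addr0.
rewrite big_ord_recl subn0 bin0; congr (_ + _).
by apply: eq_bigr => k _; rewrite lift0 -subSn // subSS.
Qed.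

(** With u = x / (1 - x), the derivation x d/dx maps p(u) / (1 - x) to
    (fubini_step p)(u) / (1 - x). *)
Definition fubini_step (R : comNzRingType) (p : {poly R}) : {poly R} :=
  'X * p + ('X + 'X^2) * p^`().

Lemma fubini_step_linear (R : comNzRingType) : linear (@fubini_step R).
Proof.
move=> c p q; rewrite /fubini_step derivD derivZ -!mul_polyC; ring.
Qed.

HB.instance Definition _ (R : comNzRingType) :=
  GRing.isLinear.Build R {poly R} {poly R} *:%R (@fubini_step R)
    (@fubini_step_linear R).

(** The value of p at the operator fubini_step, applied to the constant 1. *)
Definition fubini_umbra (R : comNzRingType) (p : {poly R}) : {poly R} :=
  \sum_(i < size p) p`_i *: iter i (@fubini_step R) 1.

Lemma fubini_umbra_widen (R : comNzRingType) (p : {poly R}) m :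
  (size p <= m)%N ->
  fubini_umbra p = \sum_(i < m) p`_i *: iter i (@fubini_step R) 1.
Proof.
move=> le_pm; pose F i := p`_i *: iter i (@fubini_step R) 1.
rewrite /fubini_umbra (big_ord_widen m F le_pm) big_mkcond /=.
apply: eq_bigr => i _; case: ltnP => // le_pi.
by rewrite /F nth_default ?scale0r.
Qed.

Lemma fubini_umbra_linear (R : comNzRingType) : linear (@fubini_umbra R).
Proof.
move=> c p q; pose m := maxn (size p) (size q).
have le_pm : (size p <= m)%N by rewrite leq_maxl.
have le_qm : (size q <= m)%N by rewrite leq_maxr.
have le_sm : (size (c *: p + q)%R <= m)%N.
  apply: leq_trans (size_polyD _ _) _.
  by rewrite geq_max le_qm (leq_trans (size_scale_leq _ _)).
rewrite !(@fubini_umbra_widen _ _ m) // scaler_sumr -big_split /=.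
by apply: eq_bigr => i _; rewrite coefD coefZ scalerDl scalerA.
Qed.

HB.instance Definition _ (R : comNzRingType) :=
  GRing.isLinear.Build R {poly R} {poly R} *:%R (@fubini_umbra R)
    (@fubini_umbra_linear R).

Lemma fubini_umbra1 (R : comNzRingType) : fubini_umbra (1 : {poly R}) = 1.
Proof. by rewrite /fubini_umbra size_poly1 big_ord1 coefC scale1r. Qed.

(** Multiplication by 'X shifts the powers of the operator by one. *)
Lemma fubini_umbraMX (R : comNzRingType) (p : {poly R}) :
  fubini_umbra (p * 'X) = fubini_step (fubini_umbra p).
Proof.
have le_pX : (size (p * 'X)%R <= (size p).+1)%N.
  by rewrite (leq_trans (size_polyMleq _ _)) // size_polyX addn2.
rewrite (fubini_umbra_widen le_pX) big_ord_recl coefMX scale0r add0r.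
rewrite /fubini_umbra linear_sum; apply: eq_bigr => i _.
by rewrite lift0 coefMX /= linearZ.
Qed.

Lemma fubini_umbraMXD (R : comNzRingType) (p : {poly R}) (c : R) :
  fubini_umbra (p * ('X + c%:P)) =
  c *: fubini_umbra p + fubini_step (fubini_umbra p).
Proof.
by rewrite mulrDr linearD /= fubini_umbraMX addrC mulrC mul_polyC linearZ.
Qed.

(** The factor 'X - k cancels the diagonal part of
    fubini_step 'X^k = k 'X^k + (k + 1) 'X^(k+1), which leaves
    (k + 1) 'X^(k+1). *)
Lemma fubini_umbra_falling (R : comNzRingType) k :
  fubini_umbra (falling ('X : {poly R}) k) = k`!%:R *: 'X^k.
Proof.
elim: k => [|k IHk].
  by rewrite /falling big_ord0 fubini_umbra1 expr0 scale1r.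
rewrite /falling big_ord_recr /= -/(falling _ k) -polyC_natr -polyCN.
rewrite fubini_umbraMXD IHk /fubini_step derivZ derivXn factS natrM.
(* The derivative k 'X^(k.-1) has a truncated exponent at k = 0. *)
case: k {IHk} => [|k]; rewrite -!mul_polyC ?polyCN ?polyCM !polyC_natr.
  rewrite fact0 mulr0n !mulr0 addr0 oppr0 mul0r add0r.
  by rewrite expr0 expr1 !mul1r mulr1.
rewrite /= !exprS; ring.
Qed.

Lemma degen_fubiniE (R : numFieldType) (mu : R) n :
  degen_fubini mu n = fubini_umbra (degen_falling mu%:P 'X n).
Proof.
rewrite (degen_stirling2P mu n) linear_sum; apply: eq_bigr => k _.
by rewrite linearZ /= fubini_umbra_falling scalerA.
Qed.

(** Umbrally the defining sum is a Vandermonde convolution of the constant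
    a / b with 'X. *)
Lemma S_polyE (R : numFieldType) (lambda a b : R) n :
  S_poly lambda a b n =
  b ^+ n *:
    fubini_umbra (degen_falling (lambda / b)%:P ((a / b)%:P + 'X) n).
Proof.
congr (_ *: _); rewrite degen_fallingD linear_sum; apply: eq_bigr => k _.
rewrite -(degen_falling_rmorph (@polyC R)) -mulrnAl -polyCMn mul_polyC.
by rewrite linearZ /= degen_fubiniE mulr_natl.
Qed.

Lemma S_poly0 (R : numFieldType) (lambda a b : R) : S_poly lambda a b 0 = 1.
Proof. by rewrite S_polyE degen_falling0 fubini_umbra1 scale1r. Qed.

(** The image under the umbra of appending the factor
    a / b + 'X - n lambda / b, multiplied by the extra power of b. *)
Lemma S_polyS (R : numFieldType) (lambda a b : R) n : b != 0 ->
  S_poly lambda a b n.+1 =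
  (a - n%:R * lambda) *: S_poly lambda a b n +
    b *: fubini_step (S_poly lambda a b n).
Proof.
move=> b0; rewrite !S_polyE degen_fallingS -polyCMn.
rewrite [_ + 'X]addrC -addrA -polyCB.
rewrite fubini_umbraMXD [fubini_step (_ *: _)]linearZ /=.
rewrite scalerDr !scalerA exprSr.
congr (_ *: _ + _ *: _); last by rewrite mulrC.
by field.
Qed.

(** The functions x^c / (1 - x^b) * p(u) with u = x^b / (1 - x^b) are stable
    under differentiation, up to x^(-1), because du/dx = b x^(-1) u (1 + u)
    and 1 / (1 - x^b) = 1 + u. *)
Lemma derive1_powR_geometric (R : realType) (c b x : R) (p : {poly R}) :
  0 < x -> x `^ b != 1 ->
  derive1 (fun y : R => y `^ c / (1 - y `^ b) * p.[y `^ b / (1 - y `^ b)]) x =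
  x `^ (c - 1) / (1 - x `^ b) *
    (c *: p + b *: fubini_step p).[x `^ b / (1 - x `^ b)].
Proof.
move=> x0 xb1.
have v0 : 1 - x `^ b != 0 by rewrite subr_eq0 eq_sym.
have dc := is_derive1_powR c x0.
have db := is_derive1_powR b x0.
have dv : is_derive x 1 (fun y : R => 1 - y `^ b) (- (b * x `^ (b - 1))).
  by rewrite -sub0r; apply: is_deriveB.
have dV := @is_deriveV R (fun y : R => 1 - y `^ b) x _ _ v0 dv.
have du := is_deriveM db dV.
have dp := is_derive1_comp (is_derive_poly p _) du.
have dy := is_deriveM (is_deriveM dc dV) dp.
rewrite derive1E; have -> := @derive_val _ _ _ _ _ _ _ dy.
have xB1 e : x `^ (e - 1) = x `^ e / x.
  by rewrite powRB ?(lt0r_neq0 x0) ?implybT // powRr1 // ltW.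
rewrite !xB1 !fctE /= /fubini_step !hornerE /GRing.scale /=.
by field; rewrite v0 gt_eqF.
Qed.

(** Absorbing the powers of x into the exponent a - n lambda keeps the
    iterates within the family treated above. *)
Lemma iter_powd_powR_geometric (R : realType) (lambda : R) n (a b x : R) :
  b != 0 -> 0 < x -> x != 1 ->
  iter n (powd lambda) (fun y : R => y `^ a / (1 - y `^ b)) x =
  x `^ (a - n%:R * lambda) / (1 - x `^ b) *
    (S_poly lambda a b n).[x `^ b / (1 - x `^ b)].
Proof.
move=> b0; elim: n x => [|n IHn] x x0 x1.
  by rewrite S_poly0 hornerC mulr1 mul0r subr0.
have xb1 : x `^ b != 1.
  by rewrite powR_eq1 (negbTE x1) (negbTE b0) ltNge ltW.
rewrite iterS /powd.
(* The induction hypothesis holds only away from 0 and 1; it determines the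
   derivative because these points form an open set. *)
have near_x : \forall y \near x, 0 < y /\ y != 1.
  apply: filterI; first exact: lt_nbhsr.
  by apply: open_nbhs_nbhs; split => //; apply: open_neq.
have eq_near : \forall y \near x,
    iter n (powd lambda) (fun y : R => y `^ a / (1 - y `^ b)) y =
    y `^ (a - n%:R * lambda) / (1 - y `^ b) *
      (S_poly lambda a b n).[y `^ b / (1 - y `^ b)].
  by apply: filterS near_x => y [y0 y1]; apply: IHn.
rewrite derive1E (near_eq_derive _ eq_near) -derive1E.
rewrite derive1_powR_geometric // S_polyS // !mulrA -powRD; last first.
  by rewrite (lt0r_neq0 x0) implybT.
by congr (_ `^ _ / _ * _); rewrite -natr1; ring.
Qed.

Theorem theorem2p4 (R : realType) (lambda : R) (n : nat) (a b x : R)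
    (hb : b != 0) (hx : 0 < x) (hx1 : x != 1) :
  x `^ (n%:R * lambda) *
    iter n (powd lambda) (fun y : R => y `^ a / (1 - y `^ b)) x =
  x `^ a / (1 - x `^ b) *
    (S_poly lambda a b n).[x `^ b / (1 - x `^ b)].
Proof.
rewrite iter_powd_powR_geometric // !mulrA -powRD; last first.
  by rewrite (lt0r_neq0 hx) implybT.
by rewrite addrC subrK.
Qed.
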